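(* There is a universal constant $C'>0$ such that the following holds. Let $p=0.5$, $\gamma>100\sqrt{\log n/n}$, and $c>0$ with $c\gamma<0.25$. There exists an adversary (corrupting at most $\gamma n$ nodes) such that, with probability at least $0.99$, the prune-then-median estimate that deletes $c\gamma n$ highest-degree and $c\gamma n$ lowest-degree nodes satisfies $|\hat p(\mathcal{A}(G))-p|\ge C'\gamma$, and the corresponding prune-then-mean estimate satisfies $|\hat p(\mathcal{A}(G))-p|\ge C'\gamma^2$, where $G\sim G(n,p)$.
   Context: $G(n,p)$ is the distribution over undirected graphs on $[n]$ with each edge present independently with probability $p$. An adversary chooses $B\subseteq[n]$ with $|B|\le\gamma n$ and may arbitrarily change the status of any edge with at least one endpoint in $B$, producing $\mathcal{A}(G)$. The prune-then-mean/median algorithm: remove the $c\gamma n$ nodes of largest degree and the $c\gamma n$ nodes of smallest degree (degrees in $\mathcal{A}(G)$); on the remaining induced graph $H$ with $m=(1-2c\gamma)n$ nodes output either $(\text{number of edges of }H)/\binom m2$ (mean) or $\mathrm{Median}\{\deg_H(v)\}/(m-1)$ (median).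
   Formalization: The corruption fraction is assumed to satisfy γ ≤ 1 (and n ≥ 1); without it the claim fails, since |p̂ − 1/2| ≤ 1/2 while γ could be arbitrarily large when c is tiny. The number cγn of pruned nodes is rounded down. *)

(* Defs.v *)
From mathcomp Require Import all_boot all_order all_algebra.
From mathcomp Require Import boolp reals exp.

Set Implicit Arguments.
Unset Strict Implicit.
Unset Printing Implicit Defensive.

Import Order.TTheory GRing.Theory Num.Theory.
Local Open Scope ring_scope.

Definition edge (n : nat) := {e : {set 'I_n} | #|e| == 2}.

Definition graph (n : nat) := {set edge n}.

Definition deg_in (n : nat) (G : graph n) (S : {set 'I_n}) (v : 'I_n) : nat :=
  #|[set e in G | (v \in val e) && (val e \subset S)]|.

Definition deg (n : nat) (G : graph n) (v : 'I_n) : nat := deg_in G setT v.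

Definition edges_in (n : nat) (G : graph n) (S : {set 'I_n}) : nat :=
  #|[set e in G | val e \subset S]|.

Definition gnp_mass (R : realType) (n : nat) (p : R) (G : graph n) : R :=
  \prod_(e : edge n) (if e \in G then p else 1 - p).

Definition gnp_prob (R : realType) (n : nat) (p : R) (E : graph n -> Prop) : R :=
  \sum_(G : graph n | `[< E G >]) gnp_mass p G.

(* The corrupted set B may depend on the sampled graph. *)
Definition node_adversary (R : realType) (n : nat) (gamma : R)
    (A : graph n -> graph n) : Prop :=
  forall G : graph n, exists B : {set 'I_n},
    #|B|%:R <= gamma * n%:R /\
    forall e : edge n, [disjoint val e & B] -> (e \in A G) = (e \in G).

(* T consists of k vertices of largest degree, L of k vertices of smallest
   degree; ties may be broken in any way, so S need not be unique. *)
Definition pruned (n : nat) (k : nat) (G : graph n) (S : {set 'I_n}) : Prop :=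
  exists T L : {set 'I_n},
    [/\ #|T| = k /\ #|L| = k,
        [disjoint T & L],
        forall u v, u \in T -> v \notin T -> (deg G v <= deg G u)%N,
        forall u v, u \in L -> v \notin L -> (deg G u <= deg G v)%N
      & S = ~: (T :|: L)].

(* Average of the two middle elements, which coincide when the size is odd. *)
Definition median (R : realType) (s : seq nat) : R :=
  let t := sort leq s in
  ((nth 0%N t (size s).-1./2)%:R + (nth 0%N t (size s)./2)%:R) / 2.

Definition mean_estimate (R : realType) (n : nat) (G : graph n)
    (S : {set 'I_n}) : R :=
  (edges_in G S)%:R / 'C(#|S|, 2)%:R.

Definition median_estimate (R : realType) (n : nat) (G : graph n)
    (S : {set 'I_n}) : R :=
  median R [seq deg_in G S v | v <- enum S] / (#|S|%:R - 1).

Lemma gnp_prob_total (R : realType) (n : nat) (p : R) :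
  gnp_prob p (fun _ : graph n => True) = 1.
Proof.
rewrite /gnp_prob /gnp_mass (eq_bigl predT); last by move=> G; rewrite asboolT.
rewrite -(bigA_distr _ _ (fun=> p) (fun=> 1 - p)) big1 // => e _.
by rewrite /= addrCA subrr addr0.
Qed.

Lemma pruned_exists (n k : nat) (G : graph n) :
  (k.*2 <= n)%N -> exists S, pruned k G S.
Proof.
move=> k2n.
have kn : (k <= n)%N by apply: leq_trans k2n; rewrite -addnn leq_addr.
pose le u v := (deg G u <= deg G v)%N.
have le_tot : total le by move=> u v; apply: leq_total.
have le_tr : transitive le by move=> u v w; apply: leq_trans.
pose s := sort le (enum 'I_n).
have us : uniq s by rewrite sort_uniq enum_uniq.
have ms v : v \in s by rewrite mem_sort mem_enum.
have ss : size s = n by rewrite size_sort size_enum_ord.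
have sle : sorted le s by apply: sort_sorted.
have cut j u v : u \in take j s -> v \in drop j s -> le u v.
  move: sle; rewrite -{1}(cat_take_drop j s) sorted_pairwise // pairwise_cat.
  by case/andP=> /allrelP h _; apply: h.
have splt j v : (v \in take j s) || (v \in drop j s).
  by rewrite -mem_cat cat_take_drop.
exists (~: ([set v in drop (n - k) s] :|: [set v in take k s])).
exists [set v in drop (n - k) s], [set v in take k s]; split => //.
- by rewrite !cardsE !(card_uniqP _) ?drop_uniq ?take_uniq // size_drop size_takel ss ?subKn.
- have : uniq (take (n - k) s ++ drop (n - k) s) by rewrite cat_take_drop.
  rewrite cat_uniq => /and3P[_ /hasPn h _].
  rewrite disjoint_subset; apply/subsetP => v; rewrite !inE => /h.
  apply: contra => vk; have kk : (k <= n - k)%N.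
    by rewrite leq_subRL // addnn.
  by move: vk; rewrite -(subnKC kk) takeD mem_cat => ->.
- move=> u v; rewrite !inE => ud vd; apply: cut ud.
  by move: (splt (n - k)%N v); rewrite (negPf vd) orbF.
- move=> u v; rewrite !inE => ut vt; apply: cut ut _.
  by move: (splt k v); rewrite (negPf vt).
Qed.

(* Main.v *)
Require Import Defs.
From mathcomp Require Import classical_sets topology normedtype sequences.
From mathcomp Require Import all_boot all_order all_algebra.
From mathcomp Require Import boolp reals exp.
From mathcomp Require Import zify ring lra.
Set Implicit Arguments.
Unset Strict Implicit.
Unset Printing Implicit Defensive.
Import Order.TTheory GRing.Theory Num.Theory numFieldNormedType.Exports.
Local Open Scope ring_scope.

(** The adversary corrupts 4b hub vertices, with b close to gamma n / 20, and
    wires them so that every other vertex has exactly 4b (top block), 3b (upper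
    block), b (lower block) or 0 (bottom block) hub neighbours, where the top
    and bottom blocks have the pruning size k, while the hubs themselves have
    degree near n / 2 + b or n / 2 - b and so survive the pruning. All degrees
    of the random part deviate from their mean by less than b / 2 (Hoeffding),
    which is at most half of every gap between blocks, so the pruning removes
    exactly the top and bottom blocks and the surviving set does not depend on
    the random graph. Among the m = n - 2k survivors the upper block is a strict
    majority, of degree at least (m + b) / 2, which moves the median by order
    gamma. The wired edges exceed half of the pairs meeting the hubs by order
    b ^ 2, while the number of random edges fluctuates by less, which moves the
    mean by order gamma ^ 2. *)

(** * Concentration of edge counts in G(n, 1/2) *)

Lemma leq_exp2_fact_double (k : nat) : (2 ^ k * k`! <= (k.*2)`!)%N.
Proof.
elim: k => // k IHk; rewrite doubleS !factS expnS.
have -> : (2 * 2 ^ k * (k.+1 * k`!) = k.*2.+2 * (2 ^ k * k`!))%N.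
  by rewrite -doubleS -muln2; ring.
by rewrite leq_mul // (leq_trans IHk) // leq_pmull.
Qed.

Lemma series_cosh_le (R : realType) (t : R) (N : nat) :
  series (exp_coeff t) (2 * N)%N + series (exp_coeff (- t)) (2 * N)%N
    <= 2 * series (exp_coeff (t ^+ 2 / 2)) N.
Proof.
elim: N => [|N IHN].
  by rewrite muln0 !seriesEnat /= !big_geq // addr0 mulr0.
rewrite mulnS !addSn !seriesSr.
have even_term : exp_coeff t (2 * N)%N <= exp_coeff (t ^+ 2 / 2) N.
  rewrite /exp_coeff /= exprM expr_div_n -mulrA ler_wpM2l //.
    by rewrite exprn_ge0 // sqr_ge0.
  rewrite -invfM -natrX -natrM lef_pV2 ?posrE ?ltr0n.
  - by rewrite ler_nat mul2n leq_exp2_fact_double.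
  - exact: fact_gt0.
  - by rewrite muln_gt0 expn_gt0 fact_gt0.
have neg_even : exp_coeff (- t) (2 * N)%N = exp_coeff t (2 * N)%N.
  by rewrite /exp_coeff /= !exprM sqrrN.
have neg_odd : exp_coeff (- t) (2 * N).+1%N = - exp_coeff t (2 * N).+1%N.
  by rewrite /exp_coeff /= !exprS !exprM sqrrN !mulNr.
rewrite neg_even neg_odd; lra.
Qed.

Lemma cosh_le_expR (R : realType) (t : R) :
  expR t + expR (- t) <= 2 * expR (t ^+ 2 / 2).
Proof.
have cvg_even (x : R) :
    (series (exp_coeff x) (2 * N)%N @[N --> \oo] --> expR x)%classic.
  have lim_exp : (series (exp_coeff x) @ \oo --> expR x)%classic.
    exact: is_cvg_series_exp_coeff.
  apply: (cvg_comp (muln 2) (series (exp_coeff x)) _ lim_exp).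
  exact: cvg_mulnl.
apply: (ler_cvg_to (cvgD (cvg_even t) (cvg_even (- t)))).
  exact: cvgMr (is_cvg_series_exp_coeff (t ^+ 2 / 2)).
by apply: nearW => N; apply: series_cosh_le.
Qed.

Lemma half_itv01 (R : realType) : 0 <= (1 / 2 : R) <= 1.
Proof. by apply/andP; split; lra. Qed.

Lemma gnp_mass_ge0 (R : realType) (n : nat) (p : R) (G : graph n) :
  0 <= p <= 1 -> 0 <= gnp_mass p G.
Proof.
by case/andP=> p0 p1; apply: prodr_ge0 => e _; case: ifP; rewrite ?subr_ge0.
Qed.

Lemma gnp_prob_true (R : realType) (n : nat) (p : R) (E : graph n -> Prop) :
  (forall G, E G) -> gnp_prob p E = 1.
Proof.
move=> ET; rewrite -(gnp_prob_total n p); apply: eq_bigl => G.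
by rewrite !asboolT.
Qed.

Lemma gnp_prob_le (R : realType) (n : nat) (p : R) (E F : graph n -> Prop) :
  0 <= p <= 1 -> (forall G, E G -> F G) -> gnp_prob p E <= gnp_prob p F.
Proof.
move=> p01 EF; rewrite /gnp_prob [leLHS]big_mkcond [leRHS]big_mkcond.
apply: ler_sum => G _; have mass_ge0 := gnp_mass_ge0 G p01.
by case: asboolP => [/EF/asboolT->|_] //; case: ifP.
Qed.

Lemma gnp_prob_forall_ge (R : realType) (n : nat) (p eps : R) (I : finType)
    (E : I -> graph n -> Prop) :
  0 <= p <= 1 -> (forall i, gnp_prob p (fun G => ~ E i G) <= eps) ->
  1 - #|I|%:R * eps <= gnp_prob p (fun G => forall i, E i G).
Proof.
move=> p01 le_eps.
apply: le_trans (_ : 1 - \sum_i gnp_prob p (fun G => ~ E i G) <= _).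
  by rewrite lerD2l lerN2 mulr_natl -sumr_const ler_sum.
rewrite lerBlDr -(gnp_prob_total n p) /gnp_prob.
under [X in _ + X]eq_bigr do rewrite big_mkcond.
rewrite exchange_big big_mkcond [X in X + _]big_mkcond -big_split /=.
apply: ler_sum => G _; rewrite asboolT //.
have mass_ge0 := gnp_mass_ge0 G p01.
have term_ge0 i : 0 <= (if `[< ~ E i G >] then gnp_mass p G else 0).
  by case: ifP.
case: asboolP => [_|/existsNP[i nEi]]; first by rewrite lerDl sumr_ge0.
by rewrite add0r (bigD1 i) //= asboolT // lerDl sumr_ge0.
Qed.

Lemma gnp_mgf (R : realType) (n : nat) (p z w : R) (X : {set edge n}) :
  \sum_(G : graph n) gnp_mass p G * (z ^+ #|X :&: G| * w ^+ #|X :\: G|)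
  = (p * z + (1 - p) * w) ^+ #|X|.
Proof.
pose present e := if e \in X then p * z else p.
pose absent e := if e \in X then (1 - p) * w else 1 - p.
transitivity
    (\sum_(G : graph n) \prod_e (if e \in G then present e else absent e)).
  apply: eq_bigr => G _; rewrite -!prodr_const /gnp_mass.
  rewrite [\prod_(i in X :&: G) z]big_mkcond [\prod_(i in X :\: G) w]big_mkcond.
  rewrite -!big_split; apply: eq_bigr => e _ /=; rewrite /present /absent !inE.
  by case: (e \in G); case: (e \in X); rewrite /= ?mulr1 ?mul1r.
rewrite -bigA_distr -prodr_const [RHS]big_mkcond; apply: eq_bigr => e _.
by rewrite /present /absent /=; case: (e \in X); ring.
Qed.

Definition balanced (n s : nat) (X : {set edge n}) (G : graph n) : bool :=
  (#|X :&: G| < s + #|X :\: G|)%N && (#|X :\: G| < s + #|X :&: G|)%N.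

Lemma gnp_half_unbalanced_markov (R : realType) (n s : nat)
    (X : {set edge n}) (t : R) :
  0 <= t ->
  gnp_prob (1 / 2) (fun G => ~ balanced s X G) * expR (s%:R * t)
    <= 2 * (1 / 2 * (expR t + expR (- t))) ^+ #|X|.
Proof.
move=> t_ge0; pose tilt (u : R) (G : graph n) :=
  expR u ^+ #|X :&: G| * expR (- u) ^+ #|X :\: G|.
have tilt_sum u : \sum_(G : graph n) gnp_mass (1 / 2) G * tilt u G
    = (1 / 2 * (expR u + expR (- u))) ^+ #|X|.
  by rewrite gnp_mgf; congr (_ ^+ _); field.
have tilt_ge u G : s%:R * t <= (#|X :&: G|%:R - #|X :\: G|%:R) * u ->
    expR (s%:R * t) <= tilt u G.
  move=> le_u; rewrite /tilt -!expRM_natl -expRD ler_expR.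
  by rewrite mulrN -mulrBl.
have := tilt_sum (- t); rewrite opprK [expR (- t) + _]addrC => tilt_sumN.
rewrite [2 * _]mulr_natl mulr2n -[X in _ <= X + _]tilt_sum -tilt_sumN.
rewrite -big_split /gnp_prob big_mkcond mulr_suml /=.
apply: ler_sum => G _; have mass_ge0 := gnp_mass_ge0 G (half_itv01 R).
have tilt_ge0 u : 0 <= tilt u G by rewrite mulr_ge0 ?exprn_ge0 ?expR_ge0.
rewrite -mulrDr; case: asboolP => [/negP unbalanced|_]; last first.
  by rewrite mul0r mulr_ge0 ?addr_ge0.
rewrite ler_wpM2l //; move: unbalanced.
rewrite negb_and -!leqNgt -!(ler_nat R) !natrD => /orP[gap|gap].
- apply: le_trans (_ : tilt t G <= _); last by rewrite lerDl.
  by apply: tilt_ge; rewrite ler_wpM2r // lerBrDr.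
- apply: le_trans (_ : tilt (- t) G <= _); last by rewrite lerDr.
  by apply: tilt_ge; rewrite mulrN -mulNr opprB ler_wpM2r // lerBrDr.
Qed.

Lemma gnp_half_unbalanced_le (R : realType) (n s : nat) (X : {set edge n})
    (t : R) :
  0 <= t ->
  gnp_prob (1 / 2) (fun G => ~ balanced s X G)
    <= 2 * expR (#|X|%:R * (t ^+ 2 / 2) - s%:R * t).
Proof.
move=> t_ge0; rewrite expRD expRN mulrA ler_pdivlMr ?expR_gt0 //.
apply: le_trans (gnp_half_unbalanced_markov s X t_ge0) _.
rewrite ler_pM2l // expRM_natl lerXn2r ?nnegrE ?expR_ge0 //.
  by rewrite mulr_ge0 ?divr_ge0 ?addr_ge0 ?expR_ge0.
by have := cosh_le_expR t; lra.
Qed.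

(* [t = s / N] minimizes the exponent [N * t ^ 2 / 2 - s * t]. *)
Lemma gnp_half_unbalanced_rare (R : realType) (n s : nat) (X : {set edge n})
    (N : R) :
  (0 < n)%N -> 0 < N -> #|X|%:R <= N -> 4 * N * ln n%:R <= s%:R ^+ 2 ->
  gnp_prob (1 / 2 : R) (fun G => ~ balanced s X G) <= 2 / n%:R ^+ 2.
Proof.
move=> n_gt0 N_gt0 XN sN; have t_ge0 : 0 <= s%:R / N by rewrite divr_ge0 // ltW.
apply: le_trans (gnp_half_unbalanced_le s X t_ge0) _; rewrite ler_pM2l //.
rewrite -(lnK (_ : n%:R \in Num.pos)) ?posrE ?ltr0n //.
rewrite -expRM_natl -expRN ler_expR.
apply: le_trans (_ : - (s%:R ^+ 2 / (2 * N)) <= _); last first.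
  by rewrite lerN2 ler_pdivlMr ?mulr_gt0 //; lra.
have -> : - (s%:R ^+ 2 / (2 * N))
    = N * ((s%:R / N) ^+ 2 / 2) - s%:R * (s%:R / N).
  by field; rewrite gt_eqF.
by rewrite lerD2r ler_wpM2r // divr_ge0 // sqr_ge0.
Qed.

(** * Degrees and edge counts *)

Definition adj (n : nat) (G : graph n) (u v : 'I_n) : bool :=
  [exists e in G, val e == [set u; v]].

Definition star (n : nat) (v : 'I_n) (S : {set 'I_n}) : graph n :=
  [set e : edge n | (v \in val e) && (val e \subset S)].

Definition clique (n : nat) (S : {set 'I_n}) : graph n :=
  [set e : edge n | val e \subset S].

Definition cross (n : nat) (X Y : {set 'I_n}) : graph n :=
  [set e : edge n | [exists u in X, exists v in Y, val e == [set u; v]]].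

Lemma edge_pair (n : nat) (u v : 'I_n) :
  u != v -> exists e : edge n, val e = [set u; v].
Proof.
move=> uv; have card_uv : #|[set u; v]| == 2%N by rewrite cards2 uv.
by exists (exist (fun A : {set _} => #|A| == 2%N) _ card_uv).
Qed.

Lemma edge_ends (n : nat) (e : edge n) (v : 'I_n) :
  v \in val e -> exists2 u, u != v & val e = [set u; v].
Proof.
move=> ve; have /cards2P[a [b [ab eab]]] := valP e.
move: ve; rewrite eab !inE => /orP[]/eqP->; last by exists a.
by exists b; rewrite 1?eq_sym // setUC.
Qed.

Lemma adjE (n : nat) (G : graph n) (e : edge n) (u v : 'I_n) :
  val e = [set u; v] -> adj G u v = (e \in G).
Proof.
move=> ee; apply/exists_inP/idP => [[e' e'G /eqP ee']|eG].
  by have -> : e = e' by apply: val_inj; rewrite ee ee'.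
by exists e; rewrite // ee.
Qed.

Lemma adj_irrefl (n : nat) (G : graph n) : irreflexive (adj G).
Proof.
move=> v; apply/exists_inP => -[e _ /eqP ee]; have := valP e.
by rewrite ee setUid cards1.
Qed.

Lemma adj_cross (n : nat) (X Y : {set 'I_n}) (u v : 'I_n) :
  u != v ->
  adj (cross X Y) u v = (u \in X) && (v \in Y) || (u \in Y) && (v \in X).
Proof.
move=> uv; have [e ee] := edge_pair uv; rewrite (adjE _ ee) inE ee.
apply/exists_inP/orP => [[x xX /exists_inP[y yY /eqP/setP xy]]|].
  move: (xy u) (xy v); rewrite !inE !eqxx !orbT => /esym.
  case/orP=> /eqP uE /esym/orP[]/eqP vE; move: uv; rewrite uE vE ?eqxx //.
    by rewrite xX yY; left.
  by rewrite xX yY; right.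
case=> /andP[uP vP]; [exists u|exists v] => //; apply/exists_inP.
  by exists v.
by exists u; rewrite // setUC.
Qed.

Lemma deg_in_notin (n : nat) (G : graph n) (S : {set 'I_n}) (v : 'I_n) :
  v \notin S -> deg_in G S v = 0%N.
Proof.
move=> vS; apply/eqP; rewrite cards_eq0; apply/eqP/setP => e; rewrite !inE.
by apply/negP => /and3P[_ ve /subsetP/(_ _ ve)]; apply/negP.
Qed.

Lemma deg_inE (n : nat) (G : graph n) (S : {set 'I_n}) (v : 'I_n) :
  v \in S -> deg_in G S v = #|[set u in S | adj G u v]|.
Proof.
move=> vS; rewrite /deg_in; set E := [set e in G | _].
set N := [set u in S | _].
have uvN u : u \in N -> u != v.
  by rewrite inE => /andP[_]; apply: contraTneq => ->; rewrite adj_irrefl.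
have edges_neighbours : [set val e | e in E] = [set [set u; v] | u in N].
  apply/setP => A; apply/imsetP/imsetP => [[e]|[u uN]].
    rewrite inE => /and3P[eG ve eS ->]; have [u uv ee] := edge_ends ve.
    by exists u => //; rewrite inE (adjE _ ee) eG (subsetP eS) // ee !inE eqxx.
  have [e ee] := edge_pair (uvN u uN); move: uN.
  rewrite inE (adjE _ ee) => /andP[uS eG ->]; exists e => //.
  rewrite inE eG ee !inE eqxx orbT.
  by apply/subsetP => w; rewrite !inE => /orP[]/eqP->.
rewrite -(card_imset _ val_inj) edges_neighbours card_in_imset // => u w uN _.
move/setP/(_ u); rewrite !inE eqxx (negPf (uvN u uN)) !orbF.
by move/esym/eqP.
Qed.

Lemma deg_in_cross (n : nat) (X Y S : {set 'I_n}) (v : 'I_n) :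
  [disjoint X & Y] -> v \in S ->
  deg_in (cross X Y) S v
    = ((if v \in X then #|S :&: Y| else 0)
       + (if v \in Y then #|S :&: X| else 0))%N.
Proof.
move=> XY vS; have notXY u : u \in X -> u \in Y = false.
  exact: disjointFr XY.
have neighbour u : adj (cross X Y) u v
    = (v \in X) && (u \in Y) || (v \in Y) && (u \in X).
  have [->|uv] := eqVneq u v; last first.
    by rewrite adj_cross // orbC andbC [X in _ || X]andbC.
  rewrite adj_irrefl; case: (boolP (v \in X)) => [/notXY->|_] //=.
  by rewrite andbF.
rewrite deg_inE //; under eq_finset do rewrite neighbour.
have [/notXY->|vX] := boolP (v \in X); last have [vY|vY] := boolP (v \in Y).
- by rewrite addn0; apply: eq_card => u; rewrite !inE /= orbF.
- by apply: eq_card => u; rewrite !inE.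
- by apply: eq_card0 => u; rewrite !inE andbF.
Qed.

Lemma edges_in_cross (n : nat) (X Y S : {set 'I_n}) :
  [disjoint X & Y] -> edges_in (cross X Y) S = (#|S :&: X| * #|S :&: Y|)%N.
Proof.
move=> XY; rewrite -cardsX /edges_in -(card_imset _ val_inj).
rewrite -(card_in_imset (f := fun uv : 'I_n * 'I_n => [set uv.1; uv.2])).
  apply: eq_card => A; apply/imsetP/imsetP => [[e]|[[u v]]].
    rewrite !inE => /andP[/exists_inP[u uX /exists_inP[v vY /eqP ee]]].
    rewrite ee subUset !sub1set => /andP[uS vS ->].
    by exists (u, v); rewrite // !inE uX vY uS vS.
  rewrite !inE => /andP[/andP[uS uX] /andP[vS vY]] -> /=.
  have uv : u != v by apply: contraTneq vY => <-; rewrite (disjointFr XY).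
  have [e ee] := edge_pair uv; exists e => //.
  rewrite inE [e \in _]inE !ee subUset !sub1set uS vS !andbT.
  by apply/exists_inP; exists u => //; apply/exists_inP; exists v.
move=> [u v] [u' v']; rewrite !inE /= => /andP[/andP[_ uX] /andP[_ vY]].
case/andP=> /andP[_ u'X] /andP[_ v'Y] /setP eq_uv.
move: (eq_uv u) (eq_uv v); rewrite !inE !eqxx orbT => /esym uE /esym vE.
have [uv' vu'] : u != v' /\ v != u'.
  by split; [apply: contraTneq v'Y => <-|apply: contraTneq vY => ->];
    rewrite (disjointFr XY).
by move: uE vE; rewrite (negPf uv') (negPf vu') orbF => /eqP-> /eqP->.
Qed.

Lemma card_setIdU (T : finType) (A B : {set T}) (P : pred T) :
  [disjoint A & B] ->
  #|[set x in A :|: B | P x]|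
    = (#|[set x in A | P x]| + #|[set x in B | P x]|)%N.
Proof.
move=> AB; rewrite !setIdE setIUl cardsU setIACA (disjoint_setI0 AB) set0I.
by rewrite cards0 subn0.
Qed.

Lemma deg_inU (n : nat) (G H : graph n) (S : {set 'I_n}) (v : 'I_n) :
  [disjoint G & H] ->
  deg_in (G :|: H) S v = (deg_in G S v + deg_in H S v)%N.
Proof. exact: card_setIdU. Qed.

Lemma edges_inU (n : nat) (G H : graph n) (S : {set 'I_n}) :
  [disjoint G & H] -> edges_in (G :|: H) S = (edges_in G S + edges_in H S)%N.
Proof. exact: card_setIdU. Qed.

Lemma deg_in_clique (n : nat) (G : graph n) (W S : {set 'I_n}) (v : 'I_n) :
  deg_in (G :&: clique W) S v = deg_in G (S :&: W) v.
Proof.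
by apply: eq_card => e; rewrite !inE subsetI -!andbA; congr (_ && _);
  rewrite andbC andbA.
Qed.

Lemma edges_in_clique (n : nat) (G : graph n) (W S : {set 'I_n}) :
  edges_in (G :&: clique W) S = edges_in G (S :&: W).
Proof.
by apply: eq_card => e; rewrite !inE subsetI -andbA [X in _ && X]andbC.
Qed.

Lemma disjoint_clique_cross (n : nat) (W X Y : {set 'I_n}) :
  [disjoint W & X] -> [disjoint clique W & cross X Y].
Proof.
move=> WX; apply/pred0P => e; rewrite !inE; apply/negP.
case/andP => eW /exists_inP[u uX /exists_inP[v _ /eqP ee]].
have uW : u \in W by rewrite (subsetP eW) // ee !inE eqxx.
by rewrite (disjointFr WX uW) in uX.
Qed.

Lemma disjoint_cross (n : nat) (X Y X' Y' : {set 'I_n}) :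
  [disjoint X & X'] -> [disjoint X & Y'] -> [disjoint cross X Y & cross X' Y'].
Proof.
move=> XX' XY'; apply/pred0P => e; rewrite !inE; apply/negP.
case/andP => /exists_inP[u uX /exists_inP[v _ /eqP ee]].
case/exists_inP => u' u'X' /exists_inP[v' v'Y' /eqP ee'].
have : u \in val e by rewrite ee !inE eqxx.
rewrite ee' !inE => /orP[]/eqP uE.
  by rewrite -uE (disjointFr XX' uX) in u'X'.
by rewrite -uE (disjointFr XY' uX) in v'Y'.
Qed.

Lemma deg_in_starI (n : nat) (G : graph n) (S : {set 'I_n}) (v : 'I_n) :
  deg_in G S v = #|star v S :&: G|.
Proof. by apply: eq_card => e; rewrite !inE andbC. Qed.

Lemma edges_in_cliqueI (n : nat) (G : graph n) (S : {set 'I_n}) :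
  edges_in G S = #|clique S :&: G|.
Proof. by apply: eq_card => e; rewrite !inE andbC. Qed.

Lemma card_star (n : nat) (v : 'I_n) (S : {set 'I_n}) :
  v \in S -> #|star v S| = #|S|.-1.
Proof.
move=> vS; rewrite -[star v S]setIT -deg_in_starI deg_inE //.
rewrite (cardsD1 v S) vS /=; apply: eq_card => u; rewrite !inE.
rewrite andbC; have [->|uv] := eqVneq u v; first by rewrite adj_irrefl.
by have [e ee] := edge_pair uv; rewrite (adjE _ ee) inE.
Qed.

Lemma card_star_le (n : nat) (v : 'I_n) (S : {set 'I_n}) : (#|star v S| <= n)%N.
Proof.
have [vS|vS] := boolP (v \in S).
  rewrite card_star // (leq_trans (leq_pred _)) //.
  by rewrite -[leqRHS]card_ord max_card.
by rewrite -[star v S]setIT -deg_in_starI deg_in_notin.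
Qed.

Lemma card_clique (n : nat) (S : {set 'I_n}) : #|clique S| = 'C(#|S|, 2).
Proof.
rewrite -cards_draws -(card_imset _ val_inj); apply: eq_card => A.
apply/imsetP/idP => [[e]|]; rewrite !inE.
  by move=> eS ->; rewrite eS (valP e).
case/andP => AS cA.
by exists (exist (fun A : {set _} => #|A| == 2%N) A cA); rewrite ?inE.
Qed.

Lemma bin2_le_half_sqr (m : nat) : (2 * 'C(m, 2) <= m ^ 2)%N.
Proof.
have : (m * m.-1 <= m ^ 2)%N by rewrite -mulnn leq_mul2l leq_pred orbT.
rewrite bin2; lia.
Qed.

Lemma bin2D (a b : nat) : 'C(a + b, 2) = ('C(a, 2) + a * b + 'C(b, 2))%N.
Proof.
rewrite -binomial.Vandermonde !big_ord_recr big_ord0 /=.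
rewrite !subSS !subn0 !bin0 !bin1; lia.
Qed.

Lemma card_clique_le (n : nat) (S : {set 'I_n}) : (#|clique S| <= n ^ 2)%N.
Proof.
have : (#|S| ^ 2 <= n ^ 2)%N.
  by rewrite leq_exp2r // -[leqRHS]card_ord max_card.
have := bin2_le_half_sqr #|S|; rewrite card_clique; lia.
Qed.

Lemma deg_in_balanced (n s : nat) (G : graph n) (S : {set 'I_n}) (v : 'I_n) :
  v \in S -> balanced s (star v S) G ->
  (#|S|.-1 < 2 * deg_in G S v + s)%N && (2 * deg_in G S v < #|S|.-1 + s)%N.
Proof.
move=> vS; rewrite -(card_star vS) /balanced -(cardsID G (star v S)).
rewrite deg_in_starI; lia.
Qed.

Lemma edges_in_balanced (n s : nat) (G : graph n) (S : {set 'I_n}) :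
  balanced s (clique S) G -> ('C(#|S|, 2) < 2 * edges_in G S + s)%N.
Proof.
rewrite -card_clique /balanced -(cardsID G (clique S)).
rewrite edges_in_cliqueI; lia.
Qed.

Lemma star_unbalanced_rare (R : realType) (n b : nat) (v : 'I_n)
    (S : {set 'I_n}) :
  (0 < n)%N -> 4 * n%:R * ln n%:R <= b%:R ^+ 2 :> R ->
  gnp_prob (1 / 2 : R) (fun G => ~ balanced b (star v S) G) <= 2 / n%:R ^+ 2.
Proof.
move=> n_gt0; apply: gnp_half_unbalanced_rare; rewrite ?ltr0n //.
by rewrite ler_nat card_star_le.
Qed.

Lemma clique_unbalanced_rare (R : realType) (n b : nat) (S : {set 'I_n}) :
  (0 < n)%N -> 1 / 2 <= ln n%:R :> R -> 4 * n%:R * ln n%:R <= b%:R ^+ 2 :> R ->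
  gnp_prob (1 / 2 : R) (fun G => ~ balanced (2 * b ^ 2) (clique S) G)
    <= 2 / n%:R ^+ 2.
Proof.
move=> n_gt0 ln_ge b_large.
apply: (gnp_half_unbalanced_rare (N := n%:R ^+ 2)) => //.
- by rewrite exprn_gt0 ?ltr0n.
- by rewrite -natrX ler_nat card_clique_le.
have n2_ln0 : 0 <= n%:R ^+ 2 * ln n%:R :> R.
  by rewrite mulr_ge0 ?sqr_ge0 //; lra.
have : n%:R ^+ 2 * ln n%:R * (1 / 2) <= n%:R ^+ 2 * ln n%:R * ln n%:R :> R.
  by rewrite ler_wpM2l.
have : (4 * n%:R * ln n%:R) ^+ 2 <= (b%:R ^+ 2) ^+ 2 :> R.
  by rewrite lerXn2r ?nnegrE ?sqr_ge0 // !mulr_ge0 ?ler0n //; lra.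
rewrite natrM natrX; lra.
Qed.

(** * Pruning, median and mean *)

Lemma extremal_set_unique (T : finType) (r : rel T) (A B : {set T}) :
  #|A| = #|B| ->
  (forall u v, u \in A -> v \notin A -> r v u) ->
  (forall u v, u \in B -> v \notin B -> ~~ r u v) -> A = B.
Proof.
move=> cAB rA rB; apply/eqP; rewrite eqEcard cAB leqnn andbT.
apply/negPn/negP => /subsetPn[u uA uB].
have /subsetPn[v vB vA] : ~~ (B \subset A).
  apply: contra uB => BA; suff /eqP-> : B == A by [].
  by rewrite eqEcard BA cAB leqnn.
by move: (rB v u vB uB); rewrite rA.
Qed.

Lemma pruned_band (n k lo hi : nat) (G : graph n) (S : {set 'I_n}) :
  #|[set v | (hi < deg G v)%N]| = k -> #|[set v | (deg G v < lo)%N]| = k ->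
  pruned k G S -> S = [set v | (lo <= deg G v <= hi)%N].
Proof.
move=> cT cL [T [L [[cardT cardL] _ maxT minL ->]]].
have -> : T = [set v | (hi < deg G v)%N].
  apply: (extremal_set_unique (r := fun v u => deg G v <= deg G u)%N) => //.
    by rewrite cardT.
  by move=> u v; rewrite !inE; lia.
have -> : L = [set v | (deg G v < lo)%N].
  apply: (extremal_set_unique (r := fun v u => deg G u <= deg G v)%N) => //.
    by rewrite cardL.
  by move=> u v; rewrite !inE; lia.
by apply/setP => v; rewrite !inE negb_or -!leqNgt andbC.
Qed.

Lemma nth_sort_ge (s : seq nat) (x i : nat) :
  (count (fun y => y < x) s <= i < size s)%N -> (x <= nth 0 (sort leq s) i)%N.
Proof.
case/andP=> count_i i_s; rewrite leqNgt; apply: contraL count_i => lt_x.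
rewrite -ltnNge -(permP (permEl (perm_sort leq s))).
set t := sort leq s in lt_x *.
have size_t : size t = size s by rewrite size_sort.
rewrite -(cat_take_drop i.+1 t) count_cat; apply: ltn_addr.
have size_take_t : size (take i.+1 t) = i.+1 by rewrite size_takel // size_t.
suff : all (fun y => y < x)%N (take i.+1 t).
  by rewrite all_count size_take_t => /eqP->.
apply/(all_nthP 0%N) => j; rewrite size_take_t => ji; rewrite nth_take //.
apply: leq_ltn_trans lt_x; apply: (sorted_leq_nth leq_trans leqnn) => //.
- by rewrite sort_sorted //; apply: leq_total.
- by rewrite inE size_t (leq_trans ji).
- by rewrite inE size_t.
Qed.

Lemma median_ge (R : realType) (s : seq nat) (x : nat) :
  (2 * count (fun y => y < x)%N s < size s)%N -> x%:R <= median R s.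
Proof.
move=> minority; rewrite /median ler_pdivlMr // mulr_natr mulr2n.
by rewrite lerD // ler_nat; apply: nth_sort_ge; lia.
Qed.

Lemma median_estimate_ge (R : realType) (n x : nat) (G : graph n)
    (S U : {set 'I_n}) :
  (2 * #|S :\: U| < #|S|)%N ->
  (forall v, v \in S -> v \in U -> (x <= deg_in G S v)%N) ->
  x%:R / (#|S|%:R - 1) <= median_estimate R G S.
Proof.
move=> minority degU; rewrite /median_estimate ler_wpM2r //.
  by rewrite invr_ge0 subr_ge0 ler1n (leq_trans _ minority).
apply: median_ge; rewrite size_map -cardE count_map -size_filter.
apply: leq_ltn_trans minority; rewrite leq_mul2l /= [leqRHS]cardE.
apply: uniq_leq_size; first by rewrite filter_uniq ?enum_uniq.
move=> v; rewrite mem_filter !mem_enum in_setD => /andP[/= low vS].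
by rewrite vS andbT; apply: contraL low => /(degU v vS); rewrite -leqNgt.
Qed.

(* Both denominators vanish on a single vertex, and [x / 0 = 0]. *)
Lemma mean_estimate_small (R : realType) (n : nat) (G : graph n)
    (S : {set 'I_n}) :
  (#|S| <= 1)%N -> mean_estimate R G S = 0.
Proof. by move=> S1; rewrite /mean_estimate bin_small // invr0 mulr0. Qed.

Lemma median_estimate_small (R : realType) (n : nat) (G : graph n)
    (S : {set 'I_n}) :
  (#|S| <= 1)%N -> median_estimate R G S = 0.
Proof.
rewrite /median_estimate leq_eqVlt ltnS leqn0 => /orP[/eqP->|].
  by rewrite subrr invr0 mulr0.
by rewrite cards_eq0 => /eqP->; rewrite enum_set0 /median /= addr0 !mul0r.
Qed.

Lemma node_adversary_overlay (R : realType) (n : nat) (gamma : R)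
    (B : {set 'I_n}) (F : graph n) :
  #|B|%:R <= gamma * n%:R -> [disjoint clique (~: B) & F] ->
  node_adversary gamma (fun G => (G :&: clique (~: B)) :|: F).
Proof.
move=> cB cF G; exists B; split => // e; rewrite disjoints_subset => eB.
have eC : e \in clique (~: B) by rewrite inE.
by rewrite !inE (disjointFr cF eC) eB andbT orbF.
Qed.

Definition ord_itv (n a b : nat) : {set 'I_n} :=
  [set i : 'I_n | (a <= i < b)%N].

Lemma card_ord_itv (n a b : nat) : (b <= n)%N -> #|ord_itv n a b| = (b - a)%N.
Proof.
move=> bn; rewrite -[RHS]muln1 -sum_nat_const_nat (big_nat_widen a b n) //.
by rewrite big_geq_mkord -sum1_card; apply: eq_bigl => i; rewrite inE andbC.
Qed.

Lemma card_ord_itvU (n a b c d : nat) :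
  (b <= c)%N -> (b <= n)%N -> (d <= n)%N ->
  #|ord_itv n a b :|: ord_itv n c d| = (b - a + (d - c))%N.
Proof.
move=> bc bn dn; rewrite cardsU !card_ord_itv // (_ : _ :&: _ = set0).
  by rewrite cards0 subn0.
by apply/setP => i; rewrite !inE; lia.
Qed.

(** * The attack *)

Section Attack.

(* The vertices are numbered so that consecutive intervals of lengths 3b, b, k,
   p, q, k are the major hubs, the minor hubs and the top, upper, lower and
   bottom blocks; [middle] is the union of the upper and lower blocks. *)
Variables n b k p q : nat.

Definition major_hubs : {set 'I_n} := ord_itv n 0 (3 * b).
Definition minor_hubs : {set 'I_n} := ord_itv n (3 * b) (4 * b).
Definition hubs : {set 'I_n} := ord_itv n 0 (4 * b).
Definition top_block : {set 'I_n} := ord_itv n (4 * b) (4 * b + k).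
Definition upper_block : {set 'I_n} := ord_itv n (4 * b + k) (4 * b + k + p).
Definition lower_block : {set 'I_n} :=
  ord_itv n (4 * b + k + p) (4 * b + k + p + q).
Definition middle : {set 'I_n} := ord_itv n (4 * b + k) (4 * b + k + p + q).
Definition bottom_block : {set 'I_n} := ord_itv n (4 * b + k + p + q) n.
Definition core : {set 'I_n} := hubs :|: middle.

Definition major_side : {set 'I_n} := minor_hubs :|: top_block :|: upper_block.
Definition minor_side : {set 'I_n} := top_block :|: lower_block.

Definition wiring : graph n :=
  cross major_hubs major_side :|: cross minor_hubs minor_side.

Definition attack (G : graph n) : graph n :=
  (G :&: clique (~: hubs)) :|: wiring.

Definition typical (G : graph n) : Prop :=
  [/\ forall v, balanced b (star v (~: hubs)) G,
      forall v, balanced b (star v middle) G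
    & balanced (2 * b ^ 2) (clique middle) G].

Lemma disjoint_major : [disjoint major_hubs & major_side].
Proof. by apply/pred0P => i; rewrite !inE; lia. Qed.

Lemma disjoint_minor : [disjoint minor_hubs & minor_side].
Proof. by apply/pred0P => i; rewrite !inE; lia. Qed.

Lemma disjoint_crosses :
  [disjoint cross major_hubs major_side & cross minor_hubs minor_side].
Proof.
by apply: disjoint_cross; apply/pred0P => i; rewrite !inE; lia.
Qed.

Lemma disjoint_clique_wiring : [disjoint clique (~: hubs) & wiring].
Proof.
rewrite -setI_eq0 setIUr setU_eq0 !setI_eq0.
by rewrite !disjoint_clique_cross //; apply/pred0P => i; rewrite !inE; lia.
Qed.

Lemma disjoint_attack (G : graph n) :
  [disjoint G :&: clique (~: hubs) & wiring].
Proof. exact: disjointWl (subsetIr _ _) disjoint_clique_wiring. Qed.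

Lemma deg_in_attack (G : graph n) (S : {set 'I_n}) (v : 'I_n) : v \in S ->
  (deg_in (attack G) S v = deg_in G (S :&: ~: hubs) v
   + ((if v \in major_hubs then #|S :&: major_side| else 0)
      + (if v \in major_side then #|S :&: major_hubs| else 0)
      + ((if v \in minor_hubs then #|S :&: minor_side| else 0)
         + (if v \in minor_side then #|S :&: minor_hubs| else 0))))%N.
Proof.
move=> vS; rewrite deg_inU ?disjoint_attack // deg_in_clique.
rewrite deg_inU ?disjoint_crosses //.
by rewrite !deg_in_cross ?disjoint_major ?disjoint_minor.
Qed.

Lemma edges_in_attack (G : graph n) (S : {set 'I_n}) :
  (edges_in (attack G) S = edges_in G (S :&: ~: hubs)
   + (#|S :&: major_hubs| * #|S :&: major_side|
      + #|S :&: minor_hubs| * #|S :&: minor_side|))%N.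
Proof.
rewrite edges_inU ?disjoint_attack // edges_in_clique.
rewrite edges_inU ?disjoint_crosses //.
by rewrite !edges_in_cross ?disjoint_major ?disjoint_minor.
Qed.

Hypothesis n_sizes : n = (4 * b + k + p + q + k)%N.

Lemma node_adversary_attack (R : realType) (gamma : R) :
  (4 * b)%:R <= gamma * n%:R -> node_adversary gamma attack.
Proof.
move=> b_le; apply: node_adversary_overlay disjoint_clique_wiring.
by rewrite card_ord_itv ?subn0 //; lia.
Qed.

Lemma card_hubsC : #|~: hubs| = (k + p + q + k)%N.
Proof.
have := cardsC hubs; rewrite card_ord card_ord_itv; lia.
Qed.

Lemma card_major_side : #|major_side| = (b + k + p)%N.
Proof.
rewrite (_ : major_side = ord_itv n (3 * b) (4 * b + k + p)).
  by rewrite card_ord_itv; lia.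
by apply/setP => i; rewrite !inE; lia.
Qed.

Lemma card_minor_side : #|minor_side| = (k + q)%N.
Proof. by rewrite card_ord_itvU; lia. Qed.

Lemma card_core : #|core| = (4 * b + p + q)%N.
Proof. by rewrite card_ord_itvU; lia. Qed.

Lemma coreI_hubsC : core :&: ~: hubs = middle.
Proof. by apply/setP => i; rewrite !inE; lia. Qed.

Lemma coreI_major_hubs : core :&: major_hubs = major_hubs.
Proof. by apply/setP => i; rewrite !inE; lia. Qed.

Lemma coreI_minor_hubs : core :&: minor_hubs = minor_hubs.
Proof. by apply/setP => i; rewrite !inE; lia. Qed.

Lemma card_coreI_major_side : #|core :&: major_side| = (b + p)%N.
Proof.
rewrite (_ : _ :&: _ = minor_hubs :|: upper_block).
  by rewrite card_ord_itvU; lia.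
by apply/setP => i; rewrite !inE; lia.
Qed.

Lemma coreI_minor_side : core :&: minor_side = lower_block.
Proof. by apply/setP => i; rewrite !inE; lia. Qed.

Hypothesis b_gt2 : (2 < b)%N.
Hypothesis majority : (4 * b + q < p <= 4 * b + q + 2)%N.

(* The random degrees concentrate around [(2 * k + p + q) / 2]; the cuts add to
   it 7b / 2, halfway between the wired degrees 3b and 4b of the upper and top
   blocks, and b / 2, halfway between those of the bottom and lower blocks. *)
Definition high_cut : nat := (2 * k + p + q + 7 * b).-1./2.
Definition low_cut : nat := uphalf (2 * k + p + q + b).

Lemma deg_attack_cuts (G : graph n) (v : 'I_n) :
  (forall v, balanced b (star v (~: hubs)) G) ->
  (high_cut < deg (attack G) v)%N = (v \in top_block)
  /\ (deg (attack G) v < low_cut)%N = (v \in bottom_block).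
Proof.
move=> bal; rewrite /deg deg_in_attack ?in_setT // !setTI.
rewrite card_major_side card_minor_side !card_ord_itv; [|lia..].
rewrite /high_cut /low_cut; have [vH|vH] := boolP (v \in ~: hubs).
  have := deg_in_balanced vH (bal v); rewrite card_hubsC.
  by move: vH; rewrite !inE; do ?[case: ifP]; have := ltn_ord v; lia.
rewrite deg_in_notin //; move: vH; rewrite !inE.
by do ?[case: ifP]; have := ltn_ord v; lia.
Qed.

Lemma pruned_attack (G : graph n) (S : {set 'I_n}) :
  (forall v, balanced b (star v (~: hubs)) G) ->
  pruned k (attack G) S -> S = core.
Proof.
move=> bal /(pruned_band (lo := low_cut) (hi := high_cut)) -> //.
- apply/setP => v; have [high low] := deg_attack_cuts v bal.
  rewrite inE leqNgt [(_ <= high_cut)%N]leqNgt high low !inE.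
  by have := ltn_ord v; lia.
- rewrite (_ : [set v | _] = top_block); first by rewrite card_ord_itv; lia.
  by apply/setP => v; rewrite inE (deg_attack_cuts v bal).1.
- rewrite (_ : [set v | _] = bottom_block); first by rewrite card_ord_itv; lia.
  by apply/setP => v; rewrite inE (deg_attack_cuts v bal).2.
Qed.

Lemma median_estimate_attack (R : realType) (G : graph n) :
  (forall v, balanced b (star v middle) G) ->
  b%:R / (2 * n%:R) <= median_estimate R (attack G) core - 1 / 2.
Proof.
move=> bal; pose x := uphalf (4 * b + p + q + b).
have minority : (2 * #|core :\: upper_block| < #|core|)%N.
  have upper_core : upper_block \subset core.
    by apply/subsetP => i; rewrite !inE; lia.
  rewrite cardsDS // card_core card_ord_itv; lia.
have deg_upper v : v \in core -> v \in upper_block ->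
    (x <= deg_in (attack G) core v)%N.
  move=> vC vU; have vM : v \in middle by move: vU; rewrite !inE; lia.
  have vS : v \in major_side by rewrite inE vU orbT.
  rewrite deg_in_attack // coreI_hubsC coreI_major_hubs vS.
  have := deg_in_balanced vM (bal v); rewrite !card_ord_itv; [|lia..].
  rewrite /x; lia.
rewrite lerBrDr; apply: le_trans (median_estimate_ge R minority deg_upper).
rewrite card_core; set m := (4 * b + p + q)%N.
have m_gt1 : 1 < m%:R :> R by rewrite ltr1n; lia.
have m_le_n : m%:R <= n%:R :> R by rewrite ler_nat; lia.
have x_ge : m%:R + b%:R <= 2 * x%:R :> R by rewrite -natrM -natrD ler_nat; lia.
have n_gt0 : 0 < n%:R :> R by lra.
have shift : b%:R / (2 * n%:R) * (m%:R - 1) <= b%:R / 2 :> R.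
  have -> : b%:R / 2 = b%:R / (2 * n%:R) * n%:R :> R.
    by field; rewrite gt_eqF.
  rewrite ler_wpM2l ?divr_ge0 ?mulr_ge0 ?ler0n //; lra.
rewrite ler_pdivlMr ?subr_gt0 // mulrDl; lra.
Qed.

Lemma edges_in_attack_core (G : graph n) :
  balanced (2 * b ^ 2) (clique middle) G ->
  ('C(4 * b + p + q, 2) + 4 * b ^ 2 <= 2 * edges_in (attack G) core)%N.
Proof.
move=> bal; have := edges_in_balanced bal; rewrite edges_in_attack coreI_hubsC.
rewrite coreI_major_hubs coreI_minor_hubs card_coreI_major_side.
rewrite coreI_minor_side !card_ord_itv; [|lia..].
rewrite (_ : 4 * b + k + p + q - (4 * b + k) = p + q)%N; last lia.
rewrite (_ : 4 * b + k + p + q - (4 * b + k + p) = q)%N; last lia.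
rewrite (_ : 4 * b - 3 * b = b)%N ?subn0; last lia.
have := bin2_le_half_sqr (4 * b); rewrite -addnA (bin2D (4 * b)).
have : (b * (4 * b + q + 1) <= b * p)%N by rewrite leq_mul2l; lia.
rewrite -!mulnn; lia.
Qed.

Lemma mean_estimate_attack (R : realType) (G : graph n) :
  balanced (2 * b ^ 2) (clique middle) G ->
  4 * (b%:R / n%:R) ^+ 2 <= mean_estimate R (attack G) core - 1 / 2.
Proof.
move/edges_in_attack_core; rewrite -(ler_nat R) natrD natrM natrX natrM.
rewrite /mean_estimate card_core lerBrDr; set m := (4 * b + p + q)%N => excess.
have n_gt0 : 0 < n%:R :> R by rewrite ltr0n; lia.
have bin_gt0 : 0 < 'C(m, 2)%:R :> R by rewrite ltr0n bin_gt0; lia.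
have bin_le : 2 * 'C(m, 2)%:R <= n%:R ^+ 2 :> R.
  rewrite -natrM -natrX ler_nat (leq_trans (bin2_le_half_sqr m)) //.
  by rewrite leq_exp2r //; lia.
have shift : 4 * (b%:R / n%:R) ^+ 2 * 'C(m, 2)%:R <= 2 * b%:R ^+ 2 :> R.
  rewrite expr_div_n mulrA mulrAC ler_pdivrMr ?exprn_gt0 //.
  have : 2 * b%:R ^+ 2 * (2 * 'C(m, 2)%:R) <= 2 * b%:R ^+ 2 * n%:R ^+ 2 :> R.
    by rewrite ler_wpM2l // mulr_ge0 ?sqr_ge0.
  lra.
rewrite ler_pdivlMr // mulrDl; lra.
Qed.

End Attack.

Lemma node_adversary_id (R : realType) (n : nat) (gamma : R) :
  0 <= gamma -> node_adversary gamma (@id (graph n)).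
Proof. by move=> gamma_ge0 G; exists set0; rewrite cards0 mulr_ge0. Qed.

Lemma gnp_prob_typical (R : realType) (n b k p q : nat) :
  500 <= n%:R :> R -> 1 / 2 <= ln n%:R :> R ->
  4 * n%:R * ln n%:R <= b%:R ^+ 2 :> R ->
  99 / 100 <= gnp_prob (1 / 2 : R) (@typical n b k p q).
Proof.
move=> n_large ln_ge b_large; have nR_gt0 : 0 < n%:R :> R by lra.
have n_gt0 : (0 < n)%N by rewrite -(ltr0n R).
pose M := middle n b k p q.
pose good (i : option ('I_n + 'I_n)) (G : graph n) : Prop := match i with
  | Some (inl v) => balanced b (star v (~: hubs n b)) G
  | Some (inr v) => balanced b (star v M) G
  | None => balanced (2 * b ^ 2) (clique M) G
  end.
have good_rare i : gnp_prob (1 / 2) (fun G => ~ good i G) <= 2 / n%:R ^+ 2 :> R.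
  case: i => [[v|v]|]; first exact: star_unbalanced_rare.
    exact: star_unbalanced_rare.
  exact: clique_unbalanced_rare.
apply: le_trans (_ : gnp_prob (1 / 2) (fun G => forall i, good i G) <= _).
  apply: le_trans (gnp_prob_forall_ge (half_itv01 R) good_rare).
  rewrite card_option card_sum card_ord.
  have -> : (n + n).+1%:R = 2 * n%:R + 1 :> R by rewrite -natr1 natrD; ring.
  have : (2 * n%:R + 1) * (2 / n%:R ^+ 2) <= 1 / 100 :> R.
    rewrite mulrA ler_pdivrMr ?exprn_gt0 //.
    have : n%:R * 500 <= n%:R * n%:R :> R by rewrite ler_pM2l.
    rewrite expr2; lra.
  lra.
apply: gnp_prob_le (half_itv01 R) _ => G all_good; split=> [v|v|].
- exact: all_good (Some (inl v)).
- exact: all_good (Some (inr v)).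
- exact: all_good None.
Qed.

Lemma half_le_ln (R : realType) (x : R) : 2 <= x -> 1 / 2 <= ln x.
Proof.
move=> x_ge2; have -> : x = (1 + - (1 - x^-1))^-1.
  by rewrite opprB addrC subrK invrK.
have xV_gt0 : 0 < x^-1 by rewrite invr_gt0; lra.
have xV_le : x^-1 <= 1 / 2 by rewrite -[_^-1]mul1r ler_pdivrMr; lra.
have := @le_ln1Dx R (- (1 - x^-1)); rewrite lnV ?posrE; lra.
Qed.

Lemma corrupted_sqr_gt (R : realType) (n : nat) (gamma : R) :
  (0 < n)%N -> 100 * Num.sqrt (ln n%:R / n%:R) < gamma ->
  100 ^+ 2 * (n%:R * ln n%:R) < (gamma * n%:R) ^+ 2.
Proof.
move=> n_gt0 gamma_gt; have nR_gt0 : 0 < n%:R :> R by rewrite ltr0n.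
have ratio0 : 0 <= ln n%:R / n%:R :> R.
  by rewrite divr_ge0 ?ln_ge0 ?ler1n // ltW.
have root0 : 0 <= 100 * Num.sqrt (ln n%:R / n%:R) :> R.
  by rewrite mulr_ge0 ?sqrtr_ge0.
have -> : 100 ^+ 2 * (n%:R * ln n%:R)
    = (100 * Num.sqrt (ln n%:R / n%:R)) ^+ 2 * n%:R ^+ 2 :> R.
  by rewrite exprMn sqr_sqrtr //; field; rewrite gt_eqF.
rewrite [ltRHS]exprMn ltr_pM2r ?exprn_gt0 // ltr_pXn2r ?nnegrE //.
by apply: le_trans (ltW gamma_gt).
Qed.

Lemma corruption_scale (R : realType) (n : nat) (gamma : R) :
  (1 < n)%N -> 0 <= gamma -> gamma <= 1 ->
  100 ^+ 2 * (n%:R * ln n%:R) < (gamma * n%:R) ^+ 2 ->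
  1 / 2 <= ln n%:R :> R /\ 500 < gamma * n%:R <= n%:R.
Proof.
move=> n_gt1 gamma_ge0 gamma_le1 scale.
have n_ge2 : 2 <= n%:R :> R by rewrite ler_nat.
have ln_ge := half_le_ln n_ge2; split=> //; apply/andP.
have gamma_n_ge0 : 0 <= gamma * n%:R by rewrite mulr_ge0.
have gamma_n_le : gamma * n%:R <= n%:R by rewrite ler_piMl.
have n_ln : n%:R * (1 / 2) <= n%:R * ln n%:R :> R by rewrite ler_wpM2l.
have n_large : 500 < n%:R :> R.
  have : (gamma * n%:R) ^+ 2 <= n%:R * n%:R.
    by rewrite -expr2 lerXn2r ?nnegrE.
  rewrite -(ltr_pM2l (_ : 0 < n%:R :> R)); lra.
split=> //; have : 500 ^+ 2 < (gamma * n%:R) ^+ 2 by lra.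
by rewrite ltr_pXn2r ?nnegrE.
Qed.

Lemma truncn_div20_bounds (R : realType) (y : R) :
  500 < y -> y / 21 <= (Num.truncn (y / 20))%:R <= y / 20.
Proof.
move=> y_large; have y20_ge0 : 0 <= y / 20 by rewrite divr_ge0 //; lra.
have := truncn_itv y20_ge0; move: (Num.truncn _) => b /andP[-> ].
rewrite -[b.+1%:R]natr1 andbT; lra.
Qed.

Lemma block_sizes (n b k : nat) :
  (50 < n)%N -> (20 * b <= n)%N -> (4 * k < n)%N ->
  exists p q,
    n = (4 * b + k + p + q + k)%N /\ (4 * b + q < p <= 4 * b + q + 2)%N.
Proof.
move=> n_gt50 bn kn; exists (n./2.+1 - k)%N, (n - k - (4 * b + n./2.+1))%N; lia.
Qed.

Lemma attack_parameters (R : realType) (n : nat) (gamma c : R) :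
  0 <= gamma -> 0 <= c -> c * gamma < 1 / 4 ->
  100 ^+ 2 * (n%:R * ln n%:R) < (gamma * n%:R) ^+ 2 -> 1 / 2 <= ln n%:R :> R ->
  500 < gamma * n%:R <= n%:R ->
  exists b p q : nat,
    [/\ n = (4 * b + Num.truncn (c * gamma * n%:R) + p + q
             + Num.truncn (c * gamma * n%:R))%N,
        (2 < b)%N, (4 * b + q < p <= 4 * b + q + 2)%N,
        (4 * b)%:R <= gamma * n%:R /\ gamma / 21 <= b%:R / n%:R
      & 4 * n%:R * ln n%:R <= b%:R ^+ 2 :> R].
Proof.
move=> gamma_ge0 c_ge0 c_gamma_lt scale ln_ge /andP[gamma_n_large gamma_n_le].
have n_gt : 500 < n%:R :> R by lra.
have nR_gt0 : 0 < n%:R :> R by lra.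
have := truncn_div20_bounds gamma_n_large.
move: (Num.truncn _) => b /andP[b_ge b_le].
have k_lt : (4 * Num.truncn (c * gamma * n%:R) < n)%N.
  have scaled_ge0 : 0 <= c * gamma * n%:R by rewrite !mulr_ge0.
  have /andP[k_le _] := truncn_itv scaled_ge0.
  have : c * gamma * n%:R < 1 / 4 * n%:R by rewrite ltr_pM2r.
  by rewrite -(ltr_nat R) natrM; lra.
have n_gt50 : (50 < n)%N by rewrite -(ltr_nat R); lra.
have b20_le : (20 * b <= n)%N by rewrite -(ler_nat R) natrM; lra.
have [p [q [sizes majority]]] := block_sizes n_gt50 b20_le k_lt.
exists b, p, q; split=> //.
- by rewrite -(ltr_nat R); lra.
- by split; [rewrite natrM; lra | rewrite ler_pdivlMr // mulrAC].
have : (gamma * n%:R / 21) ^+ 2 <= b%:R ^+ 2.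
  by rewrite lerXn2r ?nnegrE // divr_ge0 // mulr_ge0.
have : 0 <= n%:R * ln n%:R :> R by rewrite mulr_ge0 //; lra.
rewrite expr_div_n; lra.
Qed.

Lemma attack_shifts_estimates (R : realType) (n b k p q : nat) (gamma : R)
    (G : graph n) (S : {set 'I_n}) :
  n = (4 * b + k + p + q + k)%N -> (2 < b)%N ->
  (4 * b + q < p <= 4 * b + q + 2)%N ->
  0 <= gamma -> gamma / 21 <= b%:R / n%:R ->
  typical b k p q G -> pruned k (attack b k p q G) S ->
  1 / 200 * gamma <= `|median_estimate R (attack b k p q G) S - 1 / 2| /\
  1 / 200 * gamma ^+ 2 <= `|mean_estimate R (attack b k p q G) S - 1 / 2|.
Proof.
move=> n_sizes b_gt2 majority gamma_ge0 b_ge [hubs_bal stars_bal clique_bal].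
move/(pruned_attack n_sizes b_gt2 majority hubs_bal)=> ->.
have := median_estimate_attack n_sizes b_gt2 majority R stars_bal.
have := mean_estimate_attack n_sizes b_gt2 majority R clique_bal.
have sqr_ge : (gamma / 21) ^+ 2 <= (b%:R / n%:R) ^+ 2.
  by rewrite lerXn2r ?nnegrE ?divr_ge0.
have gamma2 : 0 <= gamma ^+ 2 by rewrite sqr_ge0.
move: sqr_ge; rewrite expr_div_n => sqr_ge mean_ge.
rewrite invfM mulrCA => median_ge; split.
  by apply: le_trans (ler_norm _); lra.
by apply: le_trans (ler_norm _); lra.
Qed.

Theorem theorem3p4 (R : realType) :
  exists C' : R, 0 < C' /\
    forall (n : nat) (gamma c : R),
      (0 < n)%N ->
      100 * Num.sqrt (ln n%:R / n%:R) < gamma ->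
      gamma <= 1 ->
      0 < c ->
      c * gamma < 1 / 4 ->
      exists A : graph n -> graph n,
        node_adversary gamma A /\
        99 / 100 <= gnp_prob (1 / 2 : R) (fun G : graph n =>
          forall S : {set 'I_n},
            pruned (Num.truncn (c * gamma * n%:R)) (A G) S ->
            C' * gamma <= `|median_estimate R (A G) S - 1 / 2| /\
            C' * gamma ^+ 2 <= `|mean_estimate R (A G) S - 1 / 2|).
Proof.
exists (1 / 200); split; first lra.
move=> n gamma c n_gt0 gamma_gt gamma_le1 c_gt0 c_gamma_lt.
have gamma_ge0 : 0 <= gamma.
  by apply: ltW (le_lt_trans _ gamma_gt); rewrite mulr_ge0 ?sqrtr_ge0.
have [n_le1|n_gt1] := leqP n 1.
  exists id; split; first exact: node_adversary_id.
  rewrite gnp_prob_true => [|G S _]; first lra.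
  have S1 : (#|S| <= 1)%N by rewrite (leq_trans (max_card _)) // card_ord.
  have gamma_sqr : gamma ^+ 2 <= 1 by rewrite exprn_ile1.
  rewrite median_estimate_small // mean_estimate_small // sub0r normrN.
  by rewrite ger0_norm; [split; lra | lra].
have sqr_gt := corrupted_sqr_gt n_gt0 gamma_gt.
have [ln_ge scale] := corruption_scale n_gt1 gamma_ge0 gamma_le1 sqr_gt.
have [b [p [q [sizes b_gt2 majority [b_le b_ge] b_sqr]]]] :=
  attack_parameters gamma_ge0 (ltW c_gt0) c_gamma_lt sqr_gt ln_ge scale.
set k := Num.truncn _ in sizes *.
exists (@attack n b k p q); split; first exact: node_adversary_attack.
have n_large : 500 <= n%:R :> R by case/andP: scale => /ltW; apply: le_trans.
apply: le_trans (gnp_prob_typical k p q n_large ln_ge b_sqr) _.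
apply: gnp_prob_le (half_itv01 R) _ => G typical_G S.
exact: attack_shifts_estimates.
Qed.
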